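(* Let $p\ge 1$, let $n$ be a positive integer or $\infty$, let $\{a_k\}_{k=1}^n$ and $\{b_k\}_{k=1}^n$ be non-negative non-increasing real sequences, and let $\{p_k\}_{k=1}^n$ be real weights such that $P_k:=\sum_{m=1}^k p_m\ge 0$ for $k=1,\ldots,n$. Assume $\sum_{k=1}^n p_k(a_k+b_k)^p\ne 0$ (and, if $n=\infty$, that the series below converge). Then $$0\le \frac{\left(\sum_{k=1}^n p_k a_k^p\right)^{1/p}+\left(\sum_{k=1}^n p_k b_k^p\right)^{1/p}}{\left(\sum_{k=1}^n p_k (a_k +b_k)^p\right)^{1/p}} \le 2^{1-1/p}.$$ The constant $2^{1-1/p}$ is best possible: for each $p\ge 1$ it cannot be replaced by any smaller number such that the upper bound still holds for all $n$ (a positive integer or $\infty$), all non-negative non-increasing real sequences $\{a_k\}_{k=1}^n$ and $\{b_k\}_{k=1}^n$, and all real weights $\{p_k\}_{k=1}^n$ with $\sum_{m=1}^k p_m\ge 0$ for $k=1,\ldots,n$ and $\sum_{k=1}^n p_k(a_k+b_k)^p\ne 0$ (and, if $n=\infty$, such that the series in the fraction converge). Moreover, there is no positive constant depending only on $p$ that bounds the fraction from below; that is, there is no function $c:[1,\infty)\to(0,\infty)$ such that the fraction is at least $c(p)$ for all $p\ge 1$, all $n$ (a positive integer or $\infty$), all non-negative non-increasing real sequences $\{a_k\}_{k=1}^n$ and $\{b_k\}_{k=1}^n$, and all real weights $\{p_k\}_{k=1}^n$ with $\sum_{m=1}^k p_m\ge 0$ for $k=1,\ldots,n$ and $\sum_{k=1}^n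 p_k(a_k+b_k)^p\ne 0$ (and, if $n=\infty$, such that the series in the fraction converge).
   Context: The weights $p_k$ are real numbers and may be negative; the indexed weights $p_k$ are unrelated to the exponent $p$. *)

(* Defs.v *)
From mathcomp Require Import all_boot all_order all_algebra.
From mathcomp Require Import all_classical all_reals all_analysis.
Set Implicit Arguments.
Unset Strict Implicit.
Unset Printing Implicit Defensive.
Import Order.TTheory GRing.Theory Num.Theory.
Import numFieldNormedType.Exports.
Local Open Scope classical_set_scope.
Local Open Scope ring_scope.

(* A length is [Some m] for a finite length m and [None] for infinity.
   Sequences are 0-based functions on nat: index k stands for the (k+1)-st
   term, and the terms of a finite sequence beyond its length are ignored. *)
Definition length_gt0 (n : option nat) : bool :=
  if n is Some m then (0 < m)%N else true.

Definition in_range (n : option nat) (k : nat) : bool :=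
  if n is Some m then (k < m)%N else true.

Definition seq_sum (R : realType) (n : option nat) (u : nat -> R) : R :=
  if n is Some m then \sum_(0 <= k < m) u k else limn (series u).

(* Convergence in R: possibly conditional, but with a finite sum. *)
Definition sum_exists (R : realType) (n : option nat) (u : nat -> R) : Prop :=
  if n is Some _ then True else cvgn (series u).

Definition nonneg_nonincr (R : realType) (n : option nat) (u : nat -> R) :
    Prop :=
  (forall k, in_range n k -> 0 <= u k) /\
  (forall i j, (i <= j)%N -> in_range n j -> u j <= u i).

Definition nonneg_partial_sums (R : realType) (n : option nat)
    (w : nat -> R) : Prop :=
  forall k, in_range n k -> 0 <= \sum_(0 <= m < k.+1) w m.

Definition wpow_sum (R : realType) (p : R) (n : option nat)
    (w u : nat -> R) : R :=
  seq_sum n (fun k => w k * u k `^ p).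

Definition wpow_sum_exists (R : realType) (p : R) (n : option nat)
    (w u : nat -> R) : Prop :=
  sum_exists n (fun k => w k * u k `^ p).

Definition admissible (R : realType) (p : R) (n : option nat)
    (a b w : nat -> R) : Prop :=
  length_gt0 n /\
  nonneg_nonincr n a /\ nonneg_nonincr n b /\
  nonneg_partial_sums n w /\
  wpow_sum_exists p n w a /\ wpow_sum_exists p n w b /\
  wpow_sum_exists p n w (fun k => a k + b k) /\
  wpow_sum p n w (fun k => a k + b k) != 0.

(* For admissible data the three sums are nonnegative (summation by parts),
   so [`^] is only applied to nonnegative bases, where it is the usual real
   power, with 0 `^ p^-1 = 0 for p >= 1. *)
Definition minkowski_ratio (R : realType) (p : R) (n : option nat)
    (a b w : nat -> R) : R :=
  (wpow_sum p n w a `^ p^-1 + wpow_sum p n w b `^ p^-1) /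
  wpow_sum p n w (fun k => a k + b k) `^ p^-1.

(* Main.v *)
Require Import Defs.
From mathcomp Require Import all_boot all_order all_algebra.
From mathcomp Require Import all_classical all_reals all_analysis.
From mathcomp Require Import ring lra.
Import Order.TTheory GRing.Theory Num.Theory.
Import numFieldNormedType.Exports.
Local Open Scope classical_set_scope.
Local Open Scope ring_scope.

(** The gap (x + y)^p - x^p - y^p is nonnegative and nondecreasing in x, y >= 0,
    so summation by parts against the nonnegative partial sums of the weights
    makes the weighted sum of p-th powers superadditive: with A, B and S the
    sums for a, b and a + b, one has A + B <= S.  The upper bound is then the
    power mean inequality
    A^(1/p) + B^(1/p) <= 2^(1 - 1/p) (A + B)^(1/p).
    Two-term examples show sharpness and the absence of a lower bound. *)

(** * Inequalities for real powers *)

Lemma ler_powR_l (R : realType) (r x y : R) :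
  0 <= r -> 0 <= x -> x <= y -> x `^ r <= y `^ r.
Proof.
by move=> r0 x0 xy; rewrite ge0_ler_powR// nnegrE// (le_trans x0).
Qed.

Lemma powR_convex (R : realType) (p t x y : R) :
  1 <= p -> 0 <= t <= 1 -> 0 <= x -> 0 <= y ->
  (t * x + (1 - t) * y) `^ p <= t * x `^ p + (1 - t) * y `^ p.
Proof.
move=> p1 /andP[t0 t1] x0 y0.
have := @convex_powR R p p1 (Itv01 t0 t1) x y.
rewrite !inE/= !in_itv/= !andbT => /(_ x0 y0).
by rewrite !convRE.
Qed.

(** Both [x] and [x' + y] lie in [[x', x + y]], with complementary barycentric weights [t] and
    [1 - t]. Adding the two convexity inequalities cancels [t] and leaves only the endpoint values.
    The case [x' = x] is split off so that the interval has positive length. *)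
Lemma powR_increment_le (R : realType) (p x x' y : R) :
  1 <= p -> 0 <= x' -> x' <= x -> 0 <= y ->
  (x' + y) `^ p - x' `^ p <= (x + y) `^ p - x `^ p.
Proof.
move=> p1 x'0 x'x y0.
have [->|x'Nx] := eqVneq x' x; first by [].
have d0 : 0 < x + y - x' by move: x'x; rewrite le_eqVlt (negPf x'Nx)/=; lra.
have dN0 : x + y - x' != 0 by rewrite gt_eqF.
pose t := y / (x + y - x').
have t01 : 0 <= t <= 1.
  by rewrite divr_ge0 ?(ltW d0)//= ler_pdivrMr// mul1r; lra.
have s01 : 0 <= 1 - t <= 1 by lra.
have xE : x = t * x' + (1 - t) * (x + y) by rewrite /t; field.
have x'yE : x' + y = (1 - t) * x' + (1 - (1 - t)) * (x + y)
  by rewrite /t; field.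
have xy0 : 0 <= x + y by lra.
have := @powR_convex R p t x' (x + y) p1 t01 x'0 xy0.
have := @powR_convex R p (1 - t) x' (x + y) p1 s01 x'0 xy0.
by rewrite -xE -x'yE; lra.
Qed.

(** The increment inequality is used twice: move [x'] to [x] with [y'] fixed, then [y'] to [y] with
    [x] fixed. *)
Lemma powR_superadditivity_gap_le (R : realType) (p x x' y y' : R) :
  1 <= p -> 0 <= x' <= x -> 0 <= y' <= y ->
  (x' + y') `^ p - x' `^ p - y' `^ p <= (x + y) `^ p - x `^ p - y `^ p.
Proof.
move=> p1 /andP[x'0 x'x] /andP[y'0 y'y].
have := @powR_increment_le R p x x' y' p1 x'0 x'x y'0.
have := @powR_increment_le R p y y' x p1 y'0 y'y (le_trans x'0 x'x).
by rewrite ![_ + x]addrC; lra.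
Qed.

Lemma powR_superadditive (R : realType) (p x y : R) :
  1 <= p -> 0 <= x -> 0 <= y -> x `^ p + y `^ p <= (x + y) `^ p.
Proof.
move=> p1 x0 y0.
have := @powR_superadditivity_gap_le R p x 0 y 0 p1.
rewrite !lexx x0 y0/= => /(_ isT isT).
by rewrite addr0 powR0; lra.
Qed.

(** Midpoint convexity of the [p]-th power at the [p]-th roots of [A] and [B], followed by a [p]-th
    root; the factor is 2 divided by [2 ^ (1/p)]. *)
Lemma powRVD_le (R : realType) (p A B : R) :
  1 <= p -> 0 <= A -> 0 <= B ->
  A `^ p^-1 + B `^ p^-1 <= 2 `^ (1 - p^-1) * (A + B) `^ p^-1.
Proof.
move=> p1 A0 B0.
have p0 : p != 0 by rewrite gt_eqF//; lra.
have pV0 : 0 <= p^-1 by rewrite invr_ge0; lra.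
have h01 : 0 <= (2^-1 : R) <= 1 by lra.
have := @powR_convex R p 2^-1 (A `^ p^-1) (B `^ p^-1) p1 h01
  (powR_ge0 _ _) (powR_ge0 _ _).
rewrite -!powRrM mulVf// !powRr1//.
have -> : 1 - 2^-1 = 2^-1 :> R by lra.
have s0 : 0 <= A `^ p^-1 + B `^ p^-1 by rewrite addr_ge0 ?powR_ge0.
rewrite -!mulrDr => /(@ler_powR_l R _ _ _ pV0 (powR_ge0 _ _)).
rewrite -powRrM mulfV// powRr1 ?mulr_ge0// powRM ?addr_ge0//.
rewrite powRB ?pnatr_eq0 ?implybT// powRr1//.
have -> : (2^-1 : R) `^ p^-1 = (2 `^ p^-1)^-1.
  by rewrite -[2^-1]powR_inv1// -powRN -powRrM mulN1r.
set z := (2 `^ p^-1)^-1 * _ => zle.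
by rewrite -mulrA -/z; lra.
Qed.

(** * Summation by parts for finite and infinite weighted sums *)

Section weighted_sums.
Variable R : realType.
Implicit Types (n : option nat) (u v w c : nat -> R).

(** Summation by parts as an induction: lowering the factor [c m] to [c m.+1] decreases the left
    side, since the partial sum it multiplies is nonnegative. *)
Lemma abel_sum_ge w c m :
  (forall k, (k <= m)%N -> 0 <= \sum_(0 <= i < k.+1) w i) ->
  (forall k, (k < m)%N -> c k.+1 <= c k) ->
  c m * \sum_(0 <= i < m.+1) w i <= \sum_(0 <= i < m.+1) w i * c i.
Proof.
elim: m => [|m IH] W C; first by rewrite !big_nat1 mulrC.
rewrite big_nat_recr//= [leRHS]big_nat_recr//= mulrDr [c m.+1 * w _]mulrC.
rewrite lerD2r; apply: le_trans (IH _ _) => [|k km|k km].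
- by rewrite ler_wpM2r ?W ?C.
- by apply: W; rewrite leqW.
- by apply: C; rewrite ltnW.
Qed.

Lemma weighted_partial_sum_ge0 n w c m :
  nonneg_partial_sums n w -> nonneg_nonincr n c -> in_range n m ->
  0 <= \sum_(0 <= i < m.+1) w i * c i.
Proof.
move=> W [c0 cdec] nm.
have le_range k : (k <= m)%N -> in_range n k.
  by case: n nm {W c0 cdec} => //= n nm km; exact: leq_ltn_trans km nm.
apply: le_trans (abel_sum_ge _ _ _ _ _); first by rewrite mulr_ge0 ?c0 ?W.
- by move=> k km; apply/W/le_range.
- by move=> k km; apply: cdec => //; apply: le_range.
Qed.

Lemma seq_sum_weighted_ge0 n w c :
  nonneg_partial_sums n w -> nonneg_nonincr n c ->
  sum_exists n (fun k => w k * c k) -> 0 <= seq_sum n (fun k => w k * c k).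
Proof.
move=> W C; case: n W C => [[|m]|] W C /= ex.
- by rewrite big_geq.
- exact: weighted_partial_sum_ge0 W C (ltnSn m).
- apply: limr_ge => //; apply: nearW => -[|m]; rewrite /series/=.
    by rewrite big_geq.
  exact: (weighted_partial_sum_ge0 None).
Qed.

Lemma sum_existsB n u v :
  sum_exists n u -> sum_exists n v -> sum_exists n (u \- v).
Proof. by case: n => //= cu cv; apply: is_cvg_seriesB. Qed.

Lemma seq_sumB n u v : sum_exists n u -> sum_exists n v ->
  seq_sum n (u \- v) = seq_sum n u - seq_sum n v.
Proof.
case: n => [m|] /= cu cv; first by rewrite -sumrB.
exact: lim_seriesB.
Qed.

(** The difference of the two sides is the weighted sum of the gap [z - x - y], whose convergence is
    inherited from the three given sums. *)
Lemma seq_sum_weightedD_le n w x y z :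
  nonneg_partial_sums n w -> nonneg_nonincr n (fun k => z k - x k - y k) ->
  sum_exists n (fun k => w k * x k) -> sum_exists n (fun k => w k * y k) ->
  sum_exists n (fun k => w k * z k) ->
  seq_sum n (fun k => w k * x k) + seq_sum n (fun k => w k * y k)
    <= seq_sum n (fun k => w k * z k).
Proof.
move=> W gap ex ey ez.
have exz := sum_existsB _ _ _ ez ex.
rewrite -subr_ge0 opprD addrA -(seq_sumB _ _ _ ez ex) -(seq_sumB _ _ _ exz ey).
have gapE : (fun k => w k * (z k - x k - y k)) =
    ((fun k => w k * z k) \- (fun k => w k * x k)) \- (fun k => w k * y k).
  by apply/funext => k /=; rewrite !mulrBr.
rewrite -gapE; apply: seq_sum_weighted_ge0 => //.
by rewrite gapE; exact: sum_existsB exz ey.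
Qed.

Lemma nonneg_nonincr_powR n p u :
  0 <= p -> nonneg_nonincr n u -> nonneg_nonincr n (fun k => u k `^ p).
Proof.
move=> p0 [u0 udec]; split=> [k _|i j ij nj]; first exact: powR_ge0.
have uj := u0 _ nj; have uij := udec _ _ ij nj.
exact: ler_powR_l.
Qed.

Lemma wpow_sum_ge0 p n w u :
  0 <= p -> nonneg_partial_sums n w -> nonneg_nonincr n u ->
  wpow_sum_exists p n w u -> 0 <= wpow_sum p n w u.
Proof.
move=> p0 W U; apply: (seq_sum_weighted_ge0 _ _ (fun k => u k `^ p)) => //.
exact: nonneg_nonincr_powR.
Qed.

Lemma wpow_sum_superadditive p n (a b w : nat -> R) :
  1 <= p -> nonneg_partial_sums n w ->
  nonneg_nonincr n a -> nonneg_nonincr n b ->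
  wpow_sum_exists p n w a -> wpow_sum_exists p n w b ->
  wpow_sum_exists p n w (fun k => a k + b k) ->
  wpow_sum p n w a + wpow_sum p n w b <= wpow_sum p n w (fun k => a k + b k).
Proof.
move=> p1 W [a0 adec] [b0 bdec] ea eb eab.
apply: (@seq_sum_weightedD_le n w (fun k => a k `^ p) (fun k => b k `^ p)
  (fun k => (a k + b k) `^ p) W _ ea eb eab).
split=> [k nk|i j ij nj].
  by rewrite -addrA -opprD subr_ge0 powR_superadditive ?a0 ?b0.
by rewrite powR_superadditivity_gap_le ?a0 ?b0 ?adec ?bdec.
Qed.

End weighted_sums.

(** * The upper bound, its sharpness and the absence of a lower bound *)

Lemma minkowski_ratio_le (R : realType) (p : R) (n : option nat)
    (a b w : nat -> R) :
  1 <= p -> admissible p n a b w ->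
  minkowski_ratio p n a b w <= 2 `^ (1 - p^-1).
Proof.
move=> p1 [_ [da [db [W [ea [eb [eab Sn0]]]]]]].
have p0 : 0 <= p by lra.
have pV0 : 0 <= p^-1 by rewrite invr_ge0.
have A0 := @wpow_sum_ge0 R p n w a p0 W da ea.
have B0 := @wpow_sum_ge0 R p n w b p0 W db eb.
have ABS := @wpow_sum_superadditive R p n a b w p1 W da db ea eb eab.
rewrite /minkowski_ratio.
move: (wpow_sum p n w a) (wpow_sum p n w b)
  (wpow_sum p n w (fun k => a k + b k))
  A0 B0 ABS Sn0 => {ea eb eab} A B S A0 B0 ABS Sn0.
have S0 : 0 < S by rewrite lt_neqAle eq_sym Sn0 (le_trans _ ABS)// addr_ge0.
rewrite ler_pdivrMr ?powR_gt0//.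
apply: le_trans (@powRVD_le R p _ _ p1 A0 B0) _.
by rewrite ler_wpM2l ?powR_ge0// ler_powR_l// addr_ge0.
Qed.

(* The gap (x + y)^p - x^p - y^p must be almost constant at each step: (x, y)
   drops from (1, e) to (0, e), where y is negligible, and then to (0, 0) along
   x = 0. The partial sums 1 and e^-p of the weights make both sums equal 1. *)
Lemma minkowski_ratio_near_sharp (R : realType) (p e : R) :
  1 <= p -> 0 < e ->
  exists a b w : nat -> R, admissible p (Some 2%N) a b w /\
    2 `^ (1 - p^-1) / (1 + e) <= minkowski_ratio p (Some 2%N) a b w.
Proof.
move=> p1 e0.
have p0 : 0 < p by lra.
have pN0 : p != 0 by rewrite gt_eqF.
have e1 : 0 <= 1 + e by lra.
have ep0 : 0 < e `^ p by exact: powR_gt0.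
have epN0 : e `^ p != 0 by rewrite gt_eqF.
pose a (k : nat) : R := if k is 0%N then 1 else 0.
pose b (_ : nat) : R := e.
pose w (k : nat) : R := if k is 0%N then 1 else (e `^ p)^-1 - 1.
have sum2 (u : nat -> R) : \sum_(0 <= k < 2) u k = u 0%N + u 1%N.
  by rewrite big_nat_recr// big_nat1.
have AE : wpow_sum p (Some 2%N) w a = 1.
  by rewrite /wpow_sum/= sum2/= powR1 powR0// mulr0 mulr1 addr0.
have BE : wpow_sum p (Some 2%N) w b = 1.
  by rewrite /wpow_sum/= sum2/= /b; field.
have SE : wpow_sum p (Some 2%N) w (fun k => a k + b k)
    = (1 + e) `^ p + 1 - e `^ p.
  by rewrite /wpow_sum/= sum2/= /b add0r; field.
have S1 : 1 < (1 + e) `^ p + 1 - e `^ p.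
  have := @powR_superadditive R p 1 e p1 ler01 (ltW e0); rewrite powR1; lra.
exists a, b, w; split.
  split=> //; split; [|split; [|split]].
  - split=> [[|k]|[|i] [|j]] //=; lra.
  - by split=> *; rewrite /b// ltW.
  - move=> [|[|k]]//= _; first by rewrite big_nat1/=; lra.
    by rewrite sum2/= addrC subrK invr_ge0 ltW.
  - by rewrite SE gt_eqF//; lra.
rewrite /minkowski_ratio AE BE SE powR1.
(* Superadditivity gives [1 - e^p <= (1 + e)^p]. Hence the denominator is at most
   [2^(1/p) * (1 + e)], while the numerator is 2. *)
have S2 : (1 + e) `^ p + 1 - e `^ p <= 2 * (1 + e) `^ p.
  have := @powR_superadditive R p 1 e p1 ler01 (ltW e0); rewrite powR1; lra.
have : ((1 + e) `^ p + 1 - e `^ p) `^ p^-1 <= 2 `^ p^-1 * (1 + e).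
  have eE : 1 + e = ((1 + e) `^ p) `^ p^-1 by rewrite -powRrM mulfV// powRr1.
  rewrite [X in _ <= _ * X]eE -powRM ?powR_ge0//.
  by apply: (@ler_powR_l R _ _ _ _ _ S2); rewrite ?invr_ge0; lra.
set s := _ `^ p^-1 => sle.
have s0 : 0 < s by apply: powR_gt0; lra.
have q0 : 0 < 2 `^ p^-1 :> R by apply: powR_gt0.
rewrite powRB ?pnatr_eq0 ?implybT// powRr1//.
rewrite -mulrA -invfM ler_wpM2l//.
by rewrite lef_pV2 ?posrE// mulr_gt0//; lra.
Qed.

(* The first sum is killed by constancy of a, and the other two are of order
   t^2 and t. *)
Lemma minkowski_ratio_small (R : realType) (t : R) : 0 < t ->
  exists a b w : nat -> R, admissible 2 (Some 2%N) a b w /\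
    minkowski_ratio 2 (Some 2%N) a b w ^+ 2 = t / (2 + t).
Proof.
move=> t0.
pose a (_ : nat) : R := 1.
pose b (k : nat) : R := if k is 0%N then t else 0.
pose w (k : nat) : R := if k is 0%N then 1 else -1.
have sum2 (u : nat -> R) : \sum_(0 <= k < 2) u k = u 0%N + u 1%N.
  by rewrite big_nat_recr// big_nat1.
have AE : wpow_sum 2 (Some 2%N) w a = 0.
  by rewrite /wpow_sum/= sum2/= /a powR1; lra.
have BE : wpow_sum 2 (Some 2%N) w b = t ^+ 2.
  by rewrite /wpow_sum/= sum2/= powR0// powR_mulrn ?ltW//; ring.
have SE : wpow_sum 2 (Some 2%N) w (fun k => a k + b k) = t * (2 + t).
  by rewrite /wpow_sum/= sum2/= /a addr0 powR1 powR_mulrn ?addr_ge0 ?ltW//; ring.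
have S0 : 0 < t * (2 + t) by rewrite mulr_gt0//; lra.
exists a, b, w; split.
  split=> //; split; [|split; [|split]].
  - by split=> *; rewrite /a.
  - split=> [[|k]|[|i] [|j]] //=; lra.
  - move=> [|[|k]]//= _; first by rewrite big_nat1/=; lra.
    by rewrite sum2/=; lra.
  - by rewrite SE gt_eqF.
rewrite /minkowski_ratio AE BE SE !powR12_sqrt ?lexx ?ltW ?exprn_gt0//.
rewrite sqrtr0 add0r expr_div_n !sqr_sqrtr ?ltW ?exprn_gt0//.
by field; apply/andP; split; rewrite gt_eqF//; lra.
Qed.

Theorem theorem2 (R : realType) :
  (forall (p : R) (n : option nat) (a b w : nat -> R),
      1 <= p -> admissible p n a b w ->
      0 <= minkowski_ratio p n a b w <= 2 `^ (1 - p^-1)) /\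
  (forall p C : R, 1 <= p -> C < 2 `^ (1 - p^-1) ->
      ~ (forall (n : option nat) (a b w : nat -> R),
           admissible p n a b w -> minkowski_ratio p n a b w <= C)) /\
  ~ (exists c : R -> R,
       (forall p : R, 1 <= p -> 0 < c p) /\
       (forall (p : R) (n : option nat) (a b w : nat -> R),
           1 <= p -> admissible p n a b w ->
           c p <= minkowski_ratio p n a b w)).
Proof.
split=> [p n a b w p1 adm|]; first last.
  split=> [p C p1 CK bound|[c [c0 bound]]].
    set K := 2 `^ _ in CK.
    have KC e : 0 < e -> K <= C * (1 + e).
      move=> e0; have [a [b [w [adm le]]]] := minkowski_ratio_near_sharp _ _ _ p1 e0.
      by rewrite -ler_pdivrMr; [exact: le_trans le (bound _ _ _ _ adm)|lra].
    have K0 : 0 < K by apply: powR_gt0.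
    (* The case [e = 1] gives [K <= 2 * C], so dividing by [C] is legitimate. *)
    have C0 : 0 < C by have := KC 1 ltr01; lra.
    (* This [e] makes [C * (1 + e)] the midpoint of [C] and [K], which is below [K]. *)
    have /KC : 0 < (K - C) / (2 * C) by rewrite divr_gt0//; lra.
    have -> : C * (1 + (K - C) / (2 * C)) = (K + C) / 2.
      by field; rewrite gt_eqF.
    lra.
  have c2 : 0 < c 2 by apply: c0; lra.
  have t0 : 0 < c 2 ^+ 2 by rewrite exprn_gt0.
  (* With [t = c(2)^2], the supposed bound squares to [t <= t / (2 + t)], which forces
     [2 + t <= 1]. *)
  have [a [b [w [adm E]]]] := minkowski_ratio_small _ _ t0.
  have le2 : c 2 <= minkowski_ratio 2 (Some 2%N) a b w by apply: bound => //; lra.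
  have : c 2 ^+ 2 <= minkowski_ratio 2 (Some 2%N) a b w ^+ 2.
    by rewrite lerXn2r ?nnegrE ?(le_trans (ltW c2) le2)// ltW.
  rewrite E ler_pdivlMr; last lra.
  rewrite ger_pMr//; lra.
rewrite minkowski_ratio_le// andbT.
by rewrite /minkowski_ratio divr_ge0 ?addr_ge0 ?powR_ge0.
Qed.
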